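(* Let $n\geqslant4$ and let $\mathfrak{s}_{1,n+1}^{1,2-n}$ be the $(n+1)$-dimensional complex Lie algebra with basis $e_1,\ldots,e_{n+1}$ and non-zero commutation relations \[ [e_k,e_n]=e_{k-1},\ k=2,\ldots,n-1,\qquad [e_k,e_{n+1}]=(1-k)e_k,\ k=2,\ldots,n-1,\qquad [e_n,e_{n+1}]=e_n. \] Put $\xi_1=e_1$ and $\xi_k=\sum_{j=1}^k\frac{(-1)^{k-j}}{(k-j)!}e_1^{j-2}e_2^{k-j}e_j$ for $k=3,\ldots,n-1$. Then a complete set of generalized Casimir operators of $\mathfrak{s}_{1,n+1}^{1,2-n}$ (a basis of $\mathrm{Inv}(\mathfrak{s}_{1,n+1}^{1,2-n})$) is formed by \[ \xi_1,\qquad \frac{\xi_k^2}{\xi_3^{k-1}},\quad k=4,\ldots,n-1. \]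
   Context: For a finite-dimensional complex Lie algebra $\mathfrak{g}$ with basis $e_1,\ldots,e_N$, $[e_i,e_j]=c_{ij}^ke_k$, let $x_1,\ldots,x_N$ be the coordinates on $\mathfrak{g}^*$ associated with the dual basis. An invariant of the coadjoint action is a (possibly only locally defined, on a connected open set) analytic function $F(x_1,\ldots,x_N)$ invariant under the coadjoint action, equivalently $\sum_{j,k}c_{ij}^kx_k\,\partial F/\partial x_j=0$ for all $i$. The maximal number of functionally independent invariants is $N_\mathfrak{g}=\dim\mathfrak{g}-\sup_x\operatorname{rank}(\sum_k c_{ij}^kx_k)_{i,j}$. A basis (complete set) of invariants is a set of $N_\mathfrak{g}$ functionally independent invariants (every invariant is then locally a function of them). Elements of $\mathrm{Inv}(\mathfrak{g})$ (generalized Casimir operators) are obtained from invariants by replacing $x_i$ by $e_i$ (with symmetrization of non-commuting products); here only the mutually commuting elements $e_1,\ldots,e_{n-1}$ occur, so $e_i$ may simply be read as the coordinate $x_i$. *)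

(* Defs.v *)
From HB Require Import structures.
From mathcomp Require Import all_boot all_order all_algebra.
From mathcomp Require Import ring lra zify.
From mathcomp Require Export complex.
From mathcomp Require Import all_classical all_reals all_analysis.

Set Implicit Arguments.
Unset Strict Implicit.
Unset Printing Implicit Defensive.

Import Order.TTheory GRing.Theory Num.Theory.
Import numFieldNormedType.Exports.

Local Open Scope ring_scope.
Local Open Scope classical_set_scope.

Definition lie_bracket (K : fieldType) (V : lmodType K) (br : V -> V -> V) :=
  [/\ forall (a : K) u v w, br (a *: u + v) w = a *: br u w + br v w,
      forall (a : K) u v w, br w (a *: u + v) = a *: br w u + br w v,
      forall u, br u u = 0
    & forall u v w, br u (br v w) + br v (br w u) + br w (br u v) = 0].

Section Invariants.
Variables (K : numFieldType) (N : nat).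

Definition is_domain (U : set 'rV[K]_N) := [/\ open U, connected U & U !=set0].

(* Complex differentiability at every point of an open set; for K = R[i] this *)
(* is analyticity.                                                            *)
Definition holomorphic_on (m : nat) (D : set 'rV[K]_m) (F : 'rV[K]_m -> K) :=
  forall x, D x -> differentiable F x.

(* A dependence is an analytic relation H(F_1, ..., F_m) = 0 holding on W,   *)
(* where H vanishes identically on no nonempty open part of its domain (if D  *)
(* is connected: where H is not identically zero).                            *)
Definition functionally_dependent_on (W : set 'rV[K]_N)
    (Fs : seq ('rV[K]_N -> K)) :=
  exists (D : set 'rV[K]_(size Fs)) (H : 'rV[K]_(size Fs) -> K),
    let Fx x := \row_(i < size Fs) nth (cst 0) Fs i x in
    [/\ open D, holomorphic_on D H,
        forall O, open O -> O !=set0 -> O `<=` D -> exists2 y, O y & H y != 0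
      & forall x, W x -> D (Fx x) /\ H (Fx x) = 0].

Definition functionally_independent_on (U : set 'rV[K]_N)
    (Fs : seq ('rV[K]_N -> K)) :=
  forall W, open W -> W !=set0 -> W `<=` U -> ~ functionally_dependent_on W Fs.

Variables (V : vectType K) (br : V -> V -> V) (e : N.-tuple V).

Definition structure_constant (i j k : 'I_N) : K := coord e k (br e`_i e`_j).

(* A row vector x : 'rV_N is the point of the dual space with coordinates     *)
(* x_1, ..., x_N in the basis dual to e.                                      *)
Definition coadjoint_matrix (x : 'rV[K]_N) : 'M[K]_N :=
  \matrix_(i, j) \sum_k structure_constant i j k * x 0 k.

Definition invariant_on (U : set 'rV[K]_N) (F : 'rV[K]_N -> K) :=
  holomorphic_on U F /\
  forall x, U x -> forall i,
    \sum_j \sum_k structure_constant i j k * x 0 k * 'D_('e_j) F x = 0.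

Definition coadjoint_generic_rank : nat :=
  \max_(r < N.+1 | `[< exists x, \rank (coadjoint_matrix x) = r >]) r.

Definition invariant_number : nat := (N - coadjoint_generic_rank)%N.

Definition complete_set_of_invariants (U : set 'rV[K]_N)
    (Fs : seq ('rV[K]_N -> K)) :=
  [/\ size Fs = invariant_number,
      forall i, (i < size Fs)%N -> invariant_on U (nth (cst 0) Fs i)
    & functionally_independent_on U Fs].

End Invariants.

(* The basis vector e_k is e`_k.-1, and the associated coordinate is          *)
(* x 0 (inord k.-1).                                                          *)
Definition s_relations (K : numFieldType) (n : nat) (V : vectType K)
    (br : V -> V -> V) (e : n.+1.-tuple V) :=
  let b k := e`_k.-1 in
  [/\ forall k, (2 <= k <= n.-1)%N -> br (b k) (b n) = b k.-1,
      forall k, (2 <= k <= n.-1)%N ->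
        br (b k) (b n.+1) = (1 - k%:R : K) *: b k,
      br (b n) (b n.+1) = b n
    & forall i j, (1 <= i < j)%N -> (j <= n.+1)%N -> (i == 1)%N || (j < n)%N ->
        br (b i) (b j) = 0].

(* The relations do satisfy the Jacobi identity. *)
Lemma s_lie_algebra_exists (K : numFieldType) (n : nat) : (4 <= n)%N ->
  exists (br : 'rV[K]_n.+1 -> 'rV[K]_n.+1 -> 'rV[K]_n.+1)
         (e : n.+1.-tuple 'rV[K]_n.+1),
    [/\ lie_bracket br, basis_of fullv e & s_relations br e].
Proof.
move=> n4.
pose A : 'M[K]_n.+1 := \matrix_(i, j)
  [&& (0 < i)%N, (i < n.-1)%N & j.+1 == i]%:R.
pose d (i : nat) : K :=
  if (i < n.-1)%N then - i%:R else (i == n.-1)%:R.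
pose D : 'M[K]_n.+1 := diag_mx (\row_j d j).
pose p (u : 'rV[K]_n.+1) := u 0 (inord n.-1).
pose q (u : 'rV[K]_n.+1) := u 0 (inord n).
pose br u v := p v *: (u *m A) - p u *: (v *m A)
             + (q v *: (u *m D) - q u *: (v *m D)) : 'rV[K]_n.+1.
have AD : A *m D = D *m A + A.
  apply/matrixP => i j; rewrite mul_mx_diag mul_diag_mx !mxE.
  have [/and3P[i0 i1 /eqP ji]|_] := boolP [&& _, _ & _]; last first.
    by rewrite mul0r mulr0 addr0.
  rewrite /d i1 -ji mul1r mulr1 ifT; last by lia.
  by rewrite -[j.+1]addn1 natrD opprD addrNK.
have pA u : p (u *m A) = 0.
  rewrite /p mxE; apply: big1 => l _; rewrite mxE inordK; last by lia.
  by rewrite (_ : [&& _, _ & _] = false) ?mulr0 //; apply/negbTE; lia.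
have qA u : q (u *m A) = 0.
  rewrite /q mxE; apply: big1 => l _; rewrite mxE inordK; last by lia.
  rewrite (_ : [&& _, _ & _] = false) ?mulr0 //; apply/negbTE; lia.
have pD u : p (u *m D) = p u.
  by rewrite /p mul_mx_diag !mxE /d inordK ?ltnn ?eqxx ?mulr1 //; lia.
have qD u : q (u *m D) = 0.
  rewrite /q mul_mx_diag !mxE /d inordK // ifF; last by lia.
  rewrite (_ : (n == n.-1) = false) ?mulr0 //; lia.
have pE u v : p (br u v) = q v * p u - q u * p v.
  have := pA u; have := pA v; have := pD u; have := pD v.
  by rewrite /br /p => e1 e2 e3 e4; rewrite !mxE -/A -/D in e1 e2 e3 e4 *; 
     rewrite e1 e2 e3 e4; ring.
have qE u v : q (br u v) = 0.
  have := qA u; have := qA v; have := qD u; have := qD v.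
  by rewrite /br /q => e1 e2 e3 e4; rewrite !mxE -/A -/D in e1 e2 e3 e4 *; 
     rewrite e1 e2 e3 e4; ring.
pose e : n.+1.-tuple 'rV[K]_n.+1 := [tuple delta_mx 0 i | i < n.+1].
have eE k : (k < n.+1)%N -> e`_k = delta_mx 0 (inord k).
  by move=> kn; rewrite -[k in e`_k](@inordK n k) // nth_mktuple.
exists br, e.
split; first split.
  + move=> a u v w; apply/rowP => j.
    rewrite /br /p /q !mulmxDl -!scalemxAl; rewrite !mxE; ring.
  + move=> a u v w; apply/rowP => j.
    rewrite /br /p /q !mulmxDl -!scalemxAl; rewrite !mxE; ring.
  + by move=> u; rewrite /br !subrr addr0.
  + move=> u v w; rewrite {1 3 5}/br !pE !qE.
    have brA x y : br x y *m A = p y *: (x *m A *m A) - p x *: (y *m A *m A)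
      + (q y *: (x *m D *m A) - q x *: (y *m D *m A)).
      by rewrite /br !mulmxDl !mulNmx -!scalemxAl.
    have brD x y : br x y *m D = p y *: (x *m D *m A + x *m A)
      - p x *: (y *m D *m A + y *m A)
      + (q y *: (x *m D *m D) - q x *: (y *m D *m D)).
      by rewrite /br !mulmxDl !mulNmx -!scalemxAl -!mulmxA AD !mulmxDr !mulmxA.
    rewrite !brA !brD; apply/rowP => j.
    move: (u *m A *m A) (v *m A *m A) (w *m A *m A) (u *m D *m A)
      (v *m D *m A) (w *m D *m A) (u *m D *m D) (v *m D *m D) (w *m D *m D)
      (u *m A) (v *m A) (w *m A) (u *m D) (v *m D) (w *m D).
    move: (p u) (p v) (p w) (q u) (q v) (q w) => *; rewrite !mxE; ring.
- rewrite basisEdim size_tuple dimvf /dim /= mul1n leqnn andbT.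
  apply/subvP => v _; rewrite (row_sum_delta v).
  apply: memv_suml => i _; apply/memvZ/memv_span.
  have -> : delta_mx 0 i = tnth e i by rewrite tnth_mktuple.
  exact: mem_tnth.
have bp k i : (k < n.+1)%N -> (i < n.+1)%N ->
    (e`_k : 'rV[K]_n.+1) 0 (inord i) = (k == i)%:R.
  by move=> kn i_n; rewrite eE // mxE eqxx /= -val_eqE /= !inordK // eq_sym.
have bA k : (k < n.+1)%N -> e`_k *m A =
    if (0 < k < n.-1)%N then e`_k.-1 else 0.
  move=> kn; rewrite eE // -rowE; apply/rowP => j; rewrite !mxE inordK //.
  case: ifP => [/andP[k0 k1]|]; last first.
    by rewrite mxE andbA => ->.
  rewrite k0 k1 eE; last by lia.
  rewrite mxE eqxx /= -val_eqE /= inordK; last by lia.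
  by congr (_%:R); lia.
have bD k : (k < n.+1)%N -> e`_k *m D = d k *: e`_k.
  move=> kn; rewrite eE // -rowE; apply/rowP => j; rewrite !mxE inordK //.
  by rewrite eqxx /= [j == _]eq_sym; case: eqP => _; rewrite ?mulr1 ?mulr0.
have brE k l : (k < n.+1)%N -> (l < n.+1)%N -> br e`_k e`_l =
   (l == n.-1)%:R *: (e`_k *m A) - (k == n.-1)%:R *: (e`_l *m A)
   + ((l == n)%:R *: (e`_k *m D) - (k == n)%:R *: (e`_l *m D)).
  by move=> kn ln; rewrite /br /p /q !bp //; lia.
have F (b : bool) : b = false -> b%:R = 0 :> K by move=> ->.
split.
- move=> k kn /=; rewrite brE ?bA ?bD; try lia.
  rewrite eqxx scale1r ifT; last by lia.
  by rewrite !F ?scale0r ?subr0 ?addr0 //; lia.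
- move=> k kn /=; rewrite brE ?bA ?bD; try lia.
  rewrite eqxx scale1r !F ?scale0r ?subr0 ?add0r ?sub0r ?oppr0 ?add0r; try lia.
  rewrite /d ifT; last by lia.
  by case: k kn => [|k] //= _; congr (_ *: _); rewrite -[k.+1]add1n natrD opprD addNKr.
- rewrite /= brE ?bA ?bD; try lia.
  rewrite !eqxx (F (n == n.-1)) ?(F (n.-1 == n)); try lia.
  rewrite ifF ?ifF; try lia.
  by rewrite !scale0r scaler0 !subr0 add0r scale1r /d ltnn eqxx scale1r.
- move=> i j ij jn ij1 /=; rewrite brE ?bA ?bD; try lia.
  rewrite (F (i.-1 == n.-1)) ?(F (i.-1 == n)) ?scale0r ?subr0; try lia.
  have [i1|] := eqVneq i 1; last first.
    move=> i1; rewrite !F ?scale0r ?addr0 //; lia.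
  rewrite i1 /= /d ifT; last by lia.
  by rewrite oppr0 !(scale0r, scaler0) addr0.
Qed.

Section Casimirs.
Variables (K : numFieldType) (n : nat).
Implicit Type x : 'rV[K]_n.+1.

Definition coordinate (k : nat) x : K := x 0 (inord k.-1).

Definition xi (k : nat) x : K :=
  if k == 1%N then coordinate 1 x else
  \sum_(1 <= j < k.+1)
    (-1) ^+ (k - j) / (k - j)`!%:R
      * coordinate 1 x ^ (j%:Z - 2) * coordinate 2 x ^+ (k - j)
      * coordinate j x.

Definition casimirs : seq ('rV[K]_n.+1 -> K) :=
  xi 1 :: [seq (fun x => xi k x ^+ 2 / xi 3 x ^+ k.-1) | k <- index_iota 4 n].

(* For n = 4 there is only xi_1, and no denominator at all. Otherwise the     *)
(* denominators are powers of xi_3 and the e_1^-1 of the terms j = 1 of xi_k. *)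
Definition casimir_domain : set 'rV[K]_n.+1 :=
  [set x | (4 < n)%N -> coordinate 1 x != 0 /\ xi 3 x != 0].

End Casimirs.

Arguments casimirs : clear implicits.
Arguments casimir_domain : clear implicits.

(* Main.v *)
(* In coordinates, e_n acts on functions of x_1, ..., x_(n-1) by             *)
(* - sum_j x_(j-1) d_j, e_(n+1) by sum_j (j-1) x_j d_j, and the other basis   *)
(* vectors by 0. The first field kills every xi_k and the second one          *)
(* multiplies xi_k by k - 1, whence the invariance of xi_k^2 / xi_3^(k-1).    *)
(* The coadjoint matrix has a zero block on the abelian ideal of codimension  *)
(* 2, so its rank is at most 4, and 4 is attained at x_1 = x_3 = 1. For       *)
(* independence no Jacobian is needed: the map formed by the casimirs is      *)
(* open, since each xi_k is affine in x_k with invertible slope x_1^(k-2) and *)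
(* squaring is open, so a relation H vanishes on a nonempty open set.         *)

Require Import Defs.
From HB Require Import structures.
From mathcomp Require Import all_boot all_order all_algebra.
From mathcomp Require Import ring zify.
From mathcomp Require Import complex.
From mathcomp Require Import all_classical all_reals all_analysis.

Set Implicit Arguments.
Unset Strict Implicit.
Unset Printing Implicit Defensive.

Import Order.TTheory GRing.Theory Num.Theory.
Import numFieldNormedType.Exports.

Local Open Scope ring_scope.
Local Open Scope classical_set_scope.

(** The formula for [xi] comes from a slice. The flow of e_n fixes x_1 and sends x_k to the sum over
    j <= k of (-t)^(k-j) / (k-j)! x_j. Where x_1 is non-zero it reaches the slice x_2 = 0 at t = x_2
    / x_1, and x_k takes there the value [xi k] / x_1^(k-2). Under e_(n+1) the function [xi 3] has
    weight 2, so squaring [xi k] gives a weight that an integral power of [xi 3] can cancel.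

    The count (n+1) - 4 comes from [coadjoint_generic_rank_eq4]. The invariance equations say that
    the derivative vanishes along every row of the coadjoint matrix; [coordinate_coadjoint_row]
    computes these rows and [xi_ratio_derivative] treats directions of that shape. Independence
    rests on [casimirs_partial_open], an induction that is triangular in x_1, x_4, ..., x_(n-1). It
    also covers points with [xi k] = 0, where the Jacobian drops rank, because every scalar has a
    square root and [exists_near_sqrt] controls it without choosing a branch. *)

(** * Rules for directional derivatives *)

Section DirectionalDerivative.
Variables (K : numFieldType) (V : normedModType K).
Implicit Types (x v : V) (F G : V -> K) (a b : K).

(** Since ['D_v F x] is a total function, its value alone says nothing about differentiability.
    Carrying both lets one computation yield holomorphy and the invariance equation. *)
Definition has_derivative x v F a := differentiable F x /\ 'D_v F x = a.

Lemma has_derivative_eq x v F a b :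
  has_derivative x v F a -> a = b -> has_derivative x v F b.
Proof. by move=> dF <-. Qed.

Lemma has_derivative_cst x v a : has_derivative x v (fun=> a) 0.
Proof. by split; [exact: differentiable_cst | exact: derive_cst]. Qed.

Lemma has_derivativeD x v F G a b :
  has_derivative x v F a -> has_derivative x v G b ->
  has_derivative x v (fun y => F y + G y) (a + b).
Proof.
move=> [dF <-] [dG <-]; split; first exact: differentiableD.
by apply: deriveD; exact: diff_derivable.
Qed.

Lemma has_derivativeM x v F G a b :
  has_derivative x v F a -> has_derivative x v G b ->
  has_derivative x v (fun y => F y * G y) (a * G x + F x * b).
Proof.
move=> [dF <-] [dG <-]; split; first exact: differentiableM.
by rewrite addrC [_ * G x]mulrC; apply: deriveM; exact: diff_derivable.
Qed.

Lemma has_derivativeX x v F a (m : nat) :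
  has_derivative x v F a ->
  has_derivative x v (fun y => F y ^+ m) (m%:R * F x ^+ m.-1 * a).
Proof.
move=> dF; elim: m => [|m IHm].
  by rewrite !mul0r; exact: has_derivative_cst.
have := has_derivativeM dF IHm.
have -> : (fun y => F y * F y ^+ m) = (fun y => F y ^+ m.+1).
  by apply/funext => y; rewrite exprS.
congr (has_derivative _ _ _ _); case: m {IHm} => [|m] /=; last rewrite exprS; ring.
Qed.

Lemma has_derivativeV x v F a : F x != 0 ->
  has_derivative x v F a ->
  has_derivative x v (fun y => (F y)^-1) (- (F x ^- 2 * a)).
Proof.
move=> Fx0 [dF <-]; split; first exact: differentiableV.
by rewrite deriveV ?scaleNr //; exact: diff_derivable.
Qed.

(** Integer exponents are required because the power of x_1 in the term j = 1 of [xi] is -1. *)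
Lemma has_derivative_exprz x v F a (m : int) : F x != 0 ->
  has_derivative x v F a ->
  has_derivative x v (fun y => F y ^ m) (m%:~R * F x ^ (m - 1) * a).
Proof.
move=> Fx0 dF; case: m => m; last first.
  have Fm0 : F x ^+ m.+1 != 0 by rewrite expf_neq0.
  have := has_derivativeV Fm0 (has_derivativeX m.+1 dF).
  congr (has_derivative _ _ _ _); rewrite NegzE.
  have -> : F x ^ (- m.+1%:Z - 1) = F x ^- m.+2.
    by rewrite (_ : _ - 1 = Negz m.+1) //; lia.
  rewrite mulrNz mulNr mulNr -pmulrn /= !exprS; field.
  by rewrite expf_neq0 Fx0.
apply: has_derivative_eq; first exact: (has_derivativeX m dF).
by case: m => [|m]; [rewrite !mul0r|rewrite (_ : m.+1%:Z - 1 = m) //; lia].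
Qed.

Lemma has_derivative_sum x v (I : Type) (r : seq I) (F : I -> V -> K)
    (a : I -> K) :
  (forall i, has_derivative x v (F i) (a i)) ->
  has_derivative x v (fun y => \sum_(i <- r) F i y) (\sum_(i <- r) a i).
Proof.
move=> dF; elim: r => [|i r IHr].
  rewrite big_nil (_ : (fun _ => _) = fun=> 0); last first.
    by apply/funext => y; rewrite big_nil.
  exact: has_derivative_cst.
rewrite big_cons (_ : (fun _ => _) = fun y => F i y + \sum_(j <- r) F j y).
  exact: has_derivativeD.
by apply/funext => y; rewrite big_cons.
Qed.

End DirectionalDerivative.

Lemma has_derivative_coord (K : numFieldType) (N : nat) (x v : 'rV[K]_N)
  (j : 'I_N) : has_derivative x v (fun y => y 0 j) (v 0 j).
Proof.
split; first exact: differentiable_coord.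
rewrite deriveE; last exact: differentiable_coord.
have coord_linear : linear (fun y : 'rV[K]_N => y 0 j : K).
  by move=> a u w; rewrite !mxE.
pose cL := GRing.isLinear.Build _ _ _ _ _ coord_linear.
pose f : {linear 'rV[K]_N -> K} := HB.pack (fun y : 'rV[K]_N => y 0 j) cL.
by rewrite -[fun _ => _]/(f : _ -> _) diff_lin //; exact: coord_continuous.
Qed.

(** Applied to a row of the coadjoint matrix, this turns an equation of [invariant_on] into a single
    directional derivative. *)
Lemma derive_row_sum (K : numFieldType) (N : nat) (x v : 'rV[K]_N)
    (F : 'rV[K]_N -> K) :
  differentiable F x -> 'D_v F x = \sum_j v 0 j * 'D_('e_j) F x.
Proof.
move=> dF; rewrite deriveE // {1}(row_sum_delta v) linear_sum.
by apply: eq_bigr => j _; rewrite linearZ deriveE.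
Qed.

(** * The coadjoint matrix and its generic rank *)

Section CoadjointMatrix.
Variables (K : numFieldType) (n : nat) (V : vectType K).
Variables (br : V -> V -> V) (e : n.+1.-tuple V).
Hypotheses (n_ge4 : (4 <= n)%N) (br_lie : lie_bracket br).
Hypotheses (e_basis : basis_of fullv e) (br_rel : s_relations br e).
Implicit Types (x : 'rV[K]_n.+1) (i j : 'I_n.+1).

Let dual_pairing x (u : V) : K := \sum_k coord e k u * x 0 k.

Let dual_pairingZ x (a : K) u : dual_pairing x (a *: u) = a * dual_pairing x u.
Proof.
by rewrite /dual_pairing mulr_sumr; apply: eq_bigr => k _; rewrite linearZ mulrA.
Qed.

Let dual_pairingN x u : dual_pairing x (- u) = - dual_pairing x u.
Proof. by rewrite -scaleN1r dual_pairingZ mulN1r. Qed.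

Let dual_pairing0 x : dual_pairing x 0 = 0.
Proof. by rewrite -(scale0r 0) dual_pairingZ mul0r. Qed.

Let dual_pairing_basis x (k : nat) : (k < n.+1)%N ->
  dual_pairing x e`_k = x 0 (inord k).
Proof.
move=> kn; rewrite /dual_pairing (bigD1 (inord k)) //= -[k in e`_k](inordK kn).
rewrite coord_free ?(basis_free e_basis) // eqxx mul1r big1 ?addr0 // => l /negPf.
by rewrite coord_free ?(basis_free e_basis) // eq_sym => ->; rewrite mul0r.
Qed.

Let coadjointE x i j : coadjoint_matrix br e x i j = dual_pairing x (br e`_i e`_j).
Proof. by rewrite mxE. Qed.

Let br_anti u v : br v u = - br u v.
Proof.
have [brl brr br0 _] := br_lie.
have brDl a b c : br (a + b) c = br a c + br b c.
  by have := brl 1 a b c; rewrite !scale1r.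
have brDr a b c : br c (a + b) = br c a + br c b.
  by have := brr 1 a b c; rewrite !scale1r.
apply/eqP; rewrite -addr_eq0; apply/eqP.
by have := br0 (u + v); rewrite brDl !brDr !br0 add0r addr0 addrC.
Qed.

Lemma coadjoint_matrix_anti x i j :
  coadjoint_matrix br e x i j = - coadjoint_matrix br e x j i.
Proof. by rewrite !coadjointE br_anti dual_pairingN. Qed.

(** Indices start at 0: row [n] belongs to e_(n+1), row [n.-1] to e_n, column [j] to e_(j+1). The
    factor [(0 < j)%:R] encodes that e_1 is central, as [j.-1] truncates at 0. *)
Lemma coadjoint_matrix_low x i j : (j < n.-1)%N ->
  coadjoint_matrix br e x i j =
  (i == n :> nat)%:R * j%:R * x 0 j
  - (i == n.-1 :> nat)%:R * (0 < j)%:R * x 0 (inord j.-1).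
Proof.
move=> jn; have [rel_n rel_n1 _ rel0] := br_rel.
have F (b : bool) : b = false -> b%:R = 0 :> K by move=> ->.
have [i_n|i_n] := eqVneq (i : nat) n.
  rewrite mul1r F ?mul0r ?subr0; last by lia.
  rewrite coadjoint_matrix_anti coadjointE i_n.
  have [j0|j0] := posnP j.
    by rewrite (rel0 j.+1 n.+1) ?dual_pairing0 ?oppr0 ?j0 ?mul0r //; lia.
  have /= -> := rel_n1 j.+1 ltac:(lia).
  rewrite dual_pairingZ dual_pairing_basis // inord_val.
  by rewrite -[j.+1]add1n natrD; ring.
rewrite !mul0r add0r.
have [i_n1|i_n1] := eqVneq (i : nat) n.-1.
  rewrite mul1r coadjoint_matrix_anti coadjointE i_n1.
  have [j0|j0] := posnP j.
    by rewrite (rel0 j.+1 n) ?dual_pairing0 ?oppr0 ?j0 ?mul0r ?oppr0 //; lia.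
  have /= -> := rel_n j.+1 ltac:(lia).
  by rewrite dual_pairing_basis ?mul1r //; lia.
rewrite !mul0r oppr0.
have := ltn_ord i => i_lt.
have [ij|ij|/val_inj ->] := ltngtP i j.
- by rewrite coadjointE (rel0 i.+1 j.+1) ?dual_pairing0 //; lia.
- by rewrite coadjoint_matrix_anti coadjointE (rel0 j.+1 i.+1) ?dual_pairing0 ?oppr0 //; lia.
- by rewrite coadjointE; have [_ _ -> _] := br_lie; rewrite dual_pairing0.
Qed.

Lemma coadjoint_matrix_corner x :
  coadjoint_matrix br e x (inord n.-1) (inord n) = x 0 (inord n.-1).
Proof.
have [_ _ rel_nn _] := br_rel.
rewrite coadjointE !inordK //; last by lia.
by have /= -> := rel_nn; rewrite dual_pairing_basis //; lia.
Qed.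

(** Let P project onto the last two basis vectors. The zero block gives (1 - P) M (1 - P) = 0, so M
    = P M + (1 - P) M P, and each summand has rank at most that of P, which is at most 2. *)
Lemma rank_coadjoint_matrix_le4 x : (\rank (coadjoint_matrix br e x) <= 4)%N.
Proof.
set M := coadjoint_matrix br e x.
have M0 i j : (i < n.-1)%N -> (j < n.-1)%N -> M i j = 0.
  move=> i_lt j_lt; rewrite /M coadjoint_matrix_low //.
  have [-> ->] : (i == n :> nat) = false /\ (i == n.-1 :> nat) = false by lia.
  by rewrite !mul0r subr0.
move: M M0 => M M0.
pose P : 'M[K]_n.+1 := delta_mx (inord n.-1) (inord n.-1)
                       + delta_mx (inord n) (inord n).
have rankP : (\rank P <= 2)%N.
  by rewrite (leq_trans (mxrank_add _ _)) // !mxrank_delta.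
have PE : P = diag_mx (\row_j ((n.-1 <= j)%N)%:R).
  apply/matrixP => i j; rewrite !mxE -!val_eqE /= !inordK //; last by lia.
  have := ltn_ord i; have := ltn_ord j => j_lt i_lt.
  have [<-|] := eqVneq (i : nat) j; last first.
    by move=> ij; rewrite mulr0n -natrD (_ : (_ + _)%N = 0%N) //; lia.
  by rewrite mulr1n -natrD; congr (_%:R); lia.
(* The span of e_1, ..., e_(n-1) is an abelian ideal. *)
have MP : (1%:M - P) *m M *m (1%:M - P) = 0.
  have -> : 1%:M - P = diag_mx (\row_j ((j < n.-1)%N)%:R).
    apply/matrixP => i j; rewrite PE !mxE.
    by case: eqP => _; rewrite ?subr0 // mulr1n ltnNge; case: leqP; rewrite ?subrr ?subr0.
  rewrite mul_diag_mx mul_mx_diag; apply/matrixP => i j; rewrite !mxE.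
  have [i_lt|_] := ltnP i n.-1; last by rewrite !mul0r.
  have [j_lt|_] := ltnP j n.-1; last by rewrite mulr0.
  by rewrite M0 // mulr0 mul0r.
have -> : M = P *m M + (1%:M - P) *m M *m P.
  move/eqP: MP; rewrite mulmxBr mulmx1 subr_eq0 => /eqP <-.
  by rewrite mulmxBl mul1mx addrC subrK.
rewrite (leq_trans (mxrank_add _ _)) //.
rewrite (leq_add (leq_trans (mxrankM_maxl _ _) rankP)) //.
exact: leq_trans (mxrankM_maxr _ _) rankP.
Qed.

Lemma rank_coadjoint_matrix_eq4 :
  exists x, \rank (coadjoint_matrix br e x) = 4.
Proof.
pose x : 'rV[K]_n.+1 := \row_j ((j == 0%N :> nat) || (j == 2%N :> nat))%:R.
exists x; set M := coadjoint_matrix br e x.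
apply/eqP; rewrite eqn_leq rank_coadjoint_matrix_le4 /=.
(* The minor on e_2, e_3, e_n, e_(n+1): at this point only [e_2, e_n] = e_1 and [e_3, e_(n+1)] = -2
   e_3 contribute, up to antisymmetry. *)
pose f (i : 'I_4) : 'I_n.+1 := inord (nth 0%N [:: 1; 2; n.-1; n]%N i).
pose S := mxsub f f M.
have rankS : (\rank S <= \rank M)%N.
  rewrite /S mxsubrc (leq_trans (mxrankS (rowsub_sub _ _))) //.
  by rewrite -mxrank_tr trmx_mxsub -(mxrank_tr M) mxrankS // rowsub_sub.
apply: leq_trans rankS.
have xE k : (k < n.+1)%N -> x 0 (inord k) = ((k == 0) || (k == 2))%:R.
  by move=> kn; rewrite mxE inordK.
have M_low (i j : nat) : (i < n.+1)%N -> (j < n.-1)%N -> M (inord i) (inord j) =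
    (i == n)%:R * j%:R * ((j == 0) || (j == 2))%:R
    - (i == n.-1)%:R * (0 < j)%:R * ((j.-1 == 0) || (j.-1 == 2))%:R.
  by move=> i_n jn; rewrite /M coadjoint_matrix_low ?inordK ?xE //; lia.
have M_anti i j : M i j = - M j i by exact: coadjoint_matrix_anti.
have F (b : bool) : b = false -> b%:R = 0 :> K by move=> ->.
(* The explicit inverse of the minor. *)
pose T : 'M[K]_4 := \matrix_(i, j) nth 0 (nth [::]
  [:: [:: 0; 0; -1; 0]; [:: 0; 0; 0; 2^-1]; [:: 1; 0; 0; 0];
      [:: 0; - 2^-1; 0; 0]] i) j.
suff ST : S *m T = 1%:M.
  by have := mxrankM_maxl S T; rewrite ST mxrank1.
have nn1 : (n.-1 == n) = false by lia.
have nn2 : (n == n.-1) = false by lia.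
have M0 (i j : nat) : (i < n.-1)%N -> (j < n.-1)%N -> M (inord i) (inord j) = 0.
  by move=> i_lt j_lt; rewrite M_low ?(F (i == n)) ?(F (i == n.-1)) ?mul0r ?subr0 //; lia.
have M1 (j : nat) : (j < n.-1)%N -> M (inord n.-1) (inord j) =
    - ((0 < j)%:R * ((j.-1 == 0) || (j.-1 == 2))%:R).
  by move=> j_lt; rewrite M_low ?nn1 ?eqxx ?mul0r ?mul1r ?sub0r //; lia.
have M2 (j : nat) : (j < n.-1)%N -> M (inord n) (inord j) =
    j%:R * ((j == 0) || (j == 2))%:R.
  by move=> j_lt; rewrite M_low ?nn2 ?eqxx ?mul0r ?mul1r ?subr0 //; lia.
have M3 : M (inord n.-1) (inord n) = 0.
  by rewrite /M coadjoint_matrix_corner xE ?F //; lia.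
have Mdiag i : M i i = 0.
  by apply/eqP; have /eqP := M_anti i i; rewrite -addr_eq0 -mulr2n mulrn_eq0.
pose m a b := M (inord a) (inord b).
have mN a b : m a b = - m b a by exact: M_anti.
have m_low a b : (a < n.-1)%N -> (b < n.-1)%N -> m a b = 0 by exact: M0.
have m_n1 : m n.-1 1 = -1 by rewrite /m M1 ?mulr1 //; lia.
have m_n1' : m n.-1 2 = 0 by rewrite /m M1 ?mulr0 ?oppr0 //; lia.
have m_n : m n 1 = 0 by rewrite /m M2 ?mulr0 //; lia.
have m_n' : m n 2 = 2 by rewrite /m M2 ?mulr1 //; lia.
have m_nn : m n.-1 n = 0 by exact: M3.
have m_diag a : m a a = 0 by exact: Mdiag.
have SE : S = \matrix_(i, j) m (nth 0%N [:: 1; 2; n.-1; n]%N i)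
                                 (nth 0%N [:: 1; 2; n.-1; n]%N j).
  by apply/matrixP => i j; rewrite !mxE.
rewrite SE /T; move: m mN m_low m_n1 m_n1' m_n m_n' m_nn m_diag {SE}.
move=> {}m mN m_low m_n1 m_n1' m_n m_n' m_nn m_diag.
have m11 : m 1 1 = 0 by exact: m_diag.
have m22 : m 2 2 = 0 by exact: m_diag.
have m12 : m 1 2 = 0 by apply: m_low; lia.
have m21 : m 2 1 = 0 by apply: m_low; lia.
have m1n1 : m 1 n.-1 = 1 by rewrite mN m_n1 opprK.
have m2n1 : m 2 n.-1 = 0 by rewrite mN m_n1' oppr0.
have m1n : m 1 n = 0 by rewrite mN m_n oppr0.
have m2n : m 2 n = -2 by rewrite mN m_n'.
have mn1n1 : m n.-1 n.-1 = 0 by exact: m_diag.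
have mnn : m n n = 0 by exact: m_diag.
have mnn1 : m n n.-1 = 0 by rewrite mN m_nn oppr0.
have mE := (m11, m22, m12, m21, m1n1, m2n1, m1n, m2n, mn1n1, mnn, mnn1,
            m_n1, m_n1', m_n, m_n', m_nn).
apply/matrixP => i j; rewrite !mxE !big_ord_recl big_ord0 !mxE /=.
case: i => [[|[|[|[|//]]]] ?] /=; case: j => [[|[|[|[|//]]]] ?] /=.
all: rewrite !mE ?mulr0n ?mulr1n; by field.
Qed.

Lemma coadjoint_generic_rank_eq4 : coadjoint_generic_rank br e = 4.
Proof.
apply/eqP; rewrite eqn_leq; apply/andP; split.
  apply/bigmax_leqP => r /asboolP[x <-]; exact: rank_coadjoint_matrix_le4.
have [x x4] := rank_coadjoint_matrix_eq4.
have n5 : (4 < n.+2)%N by lia.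
apply: (@leq_bigmax_cond _ _ (fun r : 'I_n.+2 => r : nat) (Ordinal n5)).
by apply/asboolP; exists x.
Qed.

End CoadjointMatrix.

(** * Invariance of the casimirs *)

Section Invariance.
Variables (K : numFieldType) (n : nat).
Implicit Types (x v : 'rV[K]_n.+1).

Lemma has_derivative_coordinate x v k :
  has_derivative x v (coordinate k) (coordinate k v).
Proof. exact: has_derivative_coord. Qed.

Let coef (m : nat) : K := (-1) ^+ m / m`!%:R.

Let coefS m : m.+1%:R * coef m.+1 = - coef m.
Proof.
rewrite /coef factS natrM exprS; field.
by rewrite nat1r !pnatr_eq0 -lt0n fact_gt0.
Qed.

(** Because e_1 is central, every direction of the coadjoint action leaves x_1 fixed; the derivative
    of its power therefore drops out. *)
Lemma has_derivative_xi x v k : k != 1%N ->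
  coordinate 1 x != 0 -> coordinate 1 v = 0 ->
  has_derivative x v (xi k) (\sum_(1 <= j < k.+1)
    coef (k - j) * coordinate 1 x ^ (j%:Z - 2) *
      ((k - j)%:R * coordinate 2 x ^+ (k - j).-1 * coordinate 2 v
         * coordinate j x
       + coordinate 2 x ^+ (k - j) * coordinate j v)).
Proof.
move=> k1 x1 v1; rewrite (_ : xi k = fun y => \sum_(1 <= j < k.+1)
    coef (k - j) * coordinate 1 y ^ (j%:Z - 2) * coordinate 2 y ^+ (k - j)
      * coordinate j y); last by apply/funext => y; rewrite /xi (negPf k1).
apply: has_derivative_sum => j.
have dx l := has_derivative_coordinate x v l.
apply: has_derivative_eq.
  apply: has_derivativeM (dx j); apply: has_derivativeM (has_derivativeX _ (dx 2)).
  apply: has_derivativeM (has_derivative_cst _ _ _) _.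
  exact: has_derivative_exprz.
rewrite v1; ring.
Qed.

(* The direction b is tangent to the coadjoint orbit: mu and lambda are the   *)
(* components along e_n and e_(n+1), under which the terms of xi telescope,   *)
(* resp. all have weight k - 1.                                               *)
Lemma xi_tangent_sum (k : nat) (a b : nat -> K) (lambda mu : K) : (2 <= k)%N ->
  a 1%N != 0 ->
  (forall j, (0 < j <= k)%N ->
     b j = lambda * j.-1%:R * a j - mu * (1 < j)%:R * a j.-1) ->
  \sum_(1 <= j < k.+1) coef (k - j) * a 1%N ^ (j%:Z - 2) *
      ((k - j)%:R * a 2 ^+ (k - j).-1 * b 2 * a j + a 2 ^+ (k - j) * b j)
  = lambda * k.-1%:R * \sum_(1 <= j < k.+1)
      coef (k - j) * a 1%N ^ (j%:Z - 2) * a 2 ^+ (k - j) * a j.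
Proof.
move=> k2 a1 bE.
(* In the j-th term, varying x_j contributes - mu [f j], while varying x_2 contributes mu [f j.+1]
   by [coefS]. The guard makes both boundary terms vanish. *)
pose f j := (1 < j <= k)%N%:R *
  (coef (k - j) * a 1%N ^ (j%:Z - 2) * a 2 ^+ (k - j) * a j.-1).
have tele : \sum_(1 <= j < k.+1) (f j.+1 - f j) = 0.
  by rewrite telescope_sumr // /f !ltnn andbF !mul0r subrr.
rewrite -[RHS]addr0 -[X in _ = _ + X](mulr0 mu).
rewrite -[X in mu * X]tele !mulr_sumr -big_split /=.
apply: eq_big_nat => j /andP[j0 jk].
rewrite (bE j) ?j0 // (bE 2) //= /f.
have -> : (1 < j.+1 <= k)%N = (j < k)%N by lia.
have -> : (1 < j <= k)%N = (1 < j)%N by lia.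
have [kj|kj] := ltnP j k; last first.
  have -> : j = k by lia.
  by rewrite subnn; case: (k) k2 => //= m _; ring.
have -> : (k - j = (k - j.+1).+1)%N by lia.
have -> : k.-1%:R = (k - j.+1).+1%:R + j.-1%:R :> K.
  by rewrite -natrD; congr (_%:R); lia.
have -> : a 1%N ^ (j.+1%:Z - 2) = a 1%N ^ (j%:Z - 2) * a 1%N.
  rewrite (_ : j.+1%:Z - 2 = (j%:Z - 2) + 1); last by lia.
  by rewrite [LHS]expfzDr.
rewrite /= -(opprK (coef (k - j.+1))) -coefS exprS; ring.
Qed.

Lemma xi_derivative x v k (lambda mu : K) : (2 <= k)%N ->
  coordinate 1 x != 0 ->
  (forall j, (0 < j <= k)%N -> coordinate j v =
     lambda * j.-1%:R * coordinate j x - mu * (1 < j)%:R * coordinate j.-1 x) ->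
  has_derivative x v (xi k) (lambda * k.-1%:R * xi k x).
Proof.
move=> k2 x1 vE; have k1 : k != 1%N by lia.
rewrite {2}/xi (negPf k1) 
  -(@xi_tangent_sum k (fun j => coordinate j x) (fun j => coordinate j v) _ mu) //.
by apply: has_derivative_xi => //; rewrite vE ?mulr0 ?mul0r ?subrr //; lia.
Qed.

Lemma xi_ratio_derivative x v k (lambda mu : K) : (3 <= k)%N ->
  coordinate 1 x != 0 -> xi 3 x != 0 ->
  (forall j, (0 < j <= k)%N -> coordinate j v =
     lambda * j.-1%:R * coordinate j x - mu * (1 < j)%:R * coordinate j.-1 x) ->
  has_derivative x v (fun y => xi k y ^+ 2 / xi 3 y ^+ k.-1) 0.
Proof.
move=> k3 x1 x3 vE.
have dk : has_derivative x v (xi k) (lambda * k.-1%:R * xi k x).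
  by apply: xi_derivative vE => //; lia.
have d3 : has_derivative x v (xi 3) (lambda * 2 * xi 3 x).
  by apply: (@xi_derivative _ _ 3 lambda mu) => // j j3; apply: vE; lia.
have x3k : xi 3 x ^+ k.-1 != 0 by rewrite expf_neq0.
apply: has_derivative_eq.
  apply: has_derivativeM (has_derivativeX 2 dk) _.
  exact: (has_derivativeV (F := fun y => xi 3 y ^+ k.-1) x3k
            (has_derivativeX k.-1 d3)).
case: k k3 {vE dk x3k} => [|[|k]] //= _; rewrite !exprS.
by field; rewrite x3 expf_neq0.
Qed.

Lemma nth_casimirs i : nth (cst 0) (casimirs K n) i =
  if i is j.+1 then
    if (j < n - 4)%N then fun x => xi j.+4 x ^+ 2 / xi 3 x ^+ j.+3 else cst 0
  else xi 1.
Proof.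
case: i => [|j] //=; case: ltnP => jn; last first.
  by rewrite nth_default // size_map size_iota.
rewrite (nth_map 0%N) ?size_iota // nth_iota // add4n.
Qed.

Lemma size_casimirs : size (casimirs K n) = (n - 4).+1.
Proof. by rewrite /= size_map size_iota. Qed.

Variables (V : vectType K) (br : V -> V -> V) (e : n.+1.-tuple V).
Hypotheses (n_ge4 : (4 <= n)%N) (br_lie : lie_bracket br).
Hypotheses (e_basis : basis_of fullv e) (br_rel : s_relations br e).

(** This matches the hypothesis of [xi_ratio_derivative], with (lambda, mu) equal to (1, 0) for
    e_(n+1), (0, 1) for e_n and (0, 0) for the rest. The range of [k] suffices, since the casimirs
    involve x_1, ..., x_(n-1) only. *)
Lemma coordinate_coadjoint_row x i k : (0 < k < n)%N ->
  coordinate k (row i (coadjoint_matrix br e x)) =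
  (i == n :> nat)%:R * k.-1%:R * coordinate k x
  - (i == n.-1 :> nat)%:R * (1 < k)%:R * coordinate k.-1 x.
Proof.
move=> kn; rewrite /coordinate [row _ _ _ _]mxE coadjoint_matrix_low //.
  by rewrite inordK; [case: k kn | lia].
by rewrite inordK; lia.
Qed.

Lemma casimir_invariant_on (U : set 'rV[K]_n.+1) (i : nat) :
  U `<=` casimir_domain K n -> (i < size (casimirs K n))%N ->
  invariant_on br e U (nth (cst 0) (casimirs K n) i).
Proof.
move=> U_dom; rewrite size_casimirs => i_lt.
have dF x l : U x -> has_derivative x (row l (coadjoint_matrix br e x))
                       (nth (cst 0) (casimirs K n) i) 0.
  move=> Ux; rewrite nth_casimirs; case: i i_lt => [_|j j_lt].
    apply: has_derivative_eq.
      exact: (has_derivative_coordinate _ _ 1).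
    by rewrite coordinate_coadjoint_row ?mulr0 ?mul0r ?subrr //; lia.
  (* A ratio occurs only when n > 4, exactly when [casimir_domain] supplies these two
     inequalities. *)
  have [|x1 x3] := U_dom x Ux; first by lia.
  rewrite ifT; last by lia.
  apply: xi_ratio_derivative => // k kj.
  by apply: coordinate_coadjoint_row; lia.
split=> [x Ux|x Ux l]; first by have [] := dF x ord0 Ux.
have [dFx D0] := dF x l Ux; rewrite -[RHS]D0 derive_row_sum //.
apply: eq_bigr => j _; rewrite !mxE mulr_suml.
by apply: eq_bigr => k _.
Qed.

End Invariance.

(** * Openness of the casimir map and functional independence *)

(** The distances from s0 to the roots s and -s have product |y - s0^2|, so the smaller one has
    square at most that. The bound remains valid at s0 = 0. *)
Lemma exists_near_sqrt (K : numFieldType) (y s0 : K) :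
  (exists s, s ^+ 2 = y) -> exists2 s, s ^+ 2 = y & `|s - s0| ^+ 2 <= `|y - s0 ^+ 2|.
Proof.
move=> [s sy].
have prodE : `|s - s0| * `|s + s0| = `|y - s0 ^+ 2|.
  by rewrite -normrM -subr_sqr sy.
have [le_s|le_s] := real_leP (normr_real (s - s0)) (normr_real (s + s0)).
  by exists s => //; rewrite -prodE expr2 ler_wpM2l.
exists (- s); first by rewrite sqrrN.
by rewrite -prodE -opprD normrN expr2 ler_wpM2r // ltW.
Qed.

Lemma cvg_exprn (K : numFieldType) (T : Type) (F : set_system T) (f : T -> K)
    (a : K) (m : nat) : Filter F ->
  f z @[z --> F] --> a -> f z ^+ m @[z --> F] --> a ^+ m.
Proof.
move=> FF fa; elim: m => [|m IHm]; first exact: cvg_cst.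
rewrite exprS; under eq_fun do rewrite exprS.
exact: cvgM.
Qed.

Section Independence.
Variables (K : numFieldType) (n : nat).
Hypothesis K_sqrt : forall y : K, exists s, s ^+ 2 = y.
Implicit Types (x w : 'rV[K]_n.+1).

Lemma coordinate_shift x (c : K) j k : (0 < j <= n.+1)%N -> (0 < k <= n.+1)%N ->
  coordinate j (x + c *: 'e_(inord k.-1)) = coordinate j x + c * (j == k)%:R.
Proof.
move=> jn kn; rewrite /coordinate !mxE eqxx /= -val_eqE /= !inordK; try lia.
by congr (_ + _ * _%:R); lia.
Qed.

(** As k >= 3, the shift leaves x_1 and x_2 alone, and only the last term of [xi l] can see x_k. *)
Lemma xi_shift x (c : K) k l : (3 <= k <= n.+1)%N -> (1 < l <= k)%N ->
  xi l (x + c *: 'e_(inord k.-1)) =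
  xi l x + (l == k)%:R * coordinate 1 x ^ (k%:Z - 2) * c.
Proof.
move=> k3 lk; rewrite /xi (_ : (l == 1%N) = false); last by lia.
rewrite !coordinate_shift; try lia.
have [-> ->] : (1 == k)%N = false /\ (2 == k)%N = false by lia.
rewrite !mulr0 !addr0.
rewrite big_nat_recr /=; last by lia.
rewrite [in RHS]big_nat_recr /=; last by lia.
rewrite coordinate_shift; try lia.
rewrite mulrDr addrA; congr (_ + _ + _).
  apply: eq_big_nat => j jl; rewrite coordinate_shift; try lia.
  by rewrite (_ : (j == k) = false) ?mulr0 ?addr0 //; lia.
rewrite subnn fact0 !expr0 divr1 mul1r mulr1.
by case: eqP => [->|_]; rewrite ?mulr1 ?mul1r ?mulr0 ?mul0r.
Qed.

Lemma continuous_coordinate k : continuous (@coordinate K n k).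
Proof. exact: coord_continuous. Qed.

Lemma continuous_at_xi w k : k != 1%N -> coordinate 1 w != 0 ->
  {for w, continuous (@xi K n k)}.
Proof.
move=> k1 w1; apply: differentiable_continuous.
(* The zero direction fixes x_1 trivially; only the differentiability half is kept. *)
have [] // := @has_derivative_xi K n w 0 k k1 w1.
by rewrite /coordinate mxE.
Qed.

Lemma continuous_coord_shift N (j : 'I_N) (a : K) w v :
  continuous (fun y : 'rV[K]_N => w + (y 0 j - a) *: v : 'rV[K]_n.+1).
Proof.
move=> y; apply: (@cvgD _ _ _ (nbhs y)); first exact: cvg_cst.
apply: cvgZr_tmp; apply: cvgB; [exact: coord_continuous | exact: cvg_cst].
Qed.

Lemma continuous_shift k :
  continuous (fun z : 'rV[K]_n.+1 * K => z.1 + z.2 *: 'e_k : 'rV[K]_n.+1).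
Proof.
move=> z; apply: (@cvgD _ _ _ (nbhs z)); first exact: cvg_fst.
apply: cvgZ; [exact: cvg_snd | exact: cvg_cst].
Qed.

Let Fx x := \row_(i < size (casimirs K n)) nth (cst 0) (casimirs K n) i x.

(* Openness is proved one casimir at a time: the k-th one is adjusted by      *)
(* moving x_k alone, which changes neither xi_1 nor any xi_l with l < k. A    *)
(* square root of the prescribed value of xi_k ^ 2 is taken close to xi_k.    *)
Lemma casimirs_partial_open w m : casimir_domain K n w -> (m <= n - 4)%N ->
  forall A, nbhs w A -> nbhs (Fx w)
    [set y : 'rV[K]_(size (casimirs K n)) | exists2 x, A x &
       forall i : 'I_(size (casimirs K n)), (i <= m)%N -> Fx x 0 i = y 0 i].
Proof.
move=> w_dom; elim: m => [_ A wA|m IHm m_lt A wA].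
  have i0 : (0 < size (casimirs K n))%N by rewrite size_casimirs.
  pose g (y : 'rV[K]_(size (casimirs K n))) :=
    w + (y 0 (Ordinal i0) - coordinate 1 w) *: 'e_(inord 1.-1) : 'rV[K]_n.+1.
  have g_cont : g y @[y --> Fx w] --> g (Fx w).
    exact: continuous_coord_shift.
  have gw : g (Fx w) = w.
    by rewrite /g mxE nth_casimirs /xi eqxx subrr scale0r addr0.
  rewrite gw in g_cont.
  have : \forall y \near Fx w, A (g y) by exact: g_cont.
  apply: filterS => y Ay; exists (g y) => // i; rewrite leqn0 => /eqP i_0.
  have -> : i = Ordinal i0 by apply: val_inj.
  have -> : Fx (g y) 0 (Ordinal i0) = coordinate 1 (g y).
    by rewrite mxE nth_casimirs.
  rewrite /g (@coordinate_shift w _ 1 1) // mulr1.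
  by rewrite addrC subrK.
have [|w1 w3] := w_dom; first by lia.
pose k := m.+4.
have i1 : (m.+1 < size (casimirs K n))%N by rewrite size_casimirs; lia.
have FxE x : Fx x 0 (Ordinal i1) = xi k x ^+ 2 / xi 3 x ^+ k.-1.
  by rewrite mxE nth_casimirs ifT //; lia.
have cst1 : {for w, continuous (@coordinate K n 1)} by exact: continuous_coordinate.
have w_k : {for w, continuous (@xi K n k)} by exact: continuous_at_xi.
have w_3 : {for w, continuous (@xi K n 3)} by exact: continuous_at_xi.
(* Base points in [P] moved along x_k by an amount in [Q] stay in [A]. *)
have /= [[P Q] /= [wP Q0] PQ] :
    \forall z \near (w, 0 : K), A (z.1 + z.2 *: 'e_(inord k.-1)).
  by apply: (@continuous_shift _ (w, 0 : K)); rewrite /= scale0r addr0.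
have [r r0 rQ] : exists2 r : K, 0 < r & forall c, `|c| < r -> Q c.
  have /nbhs_ballP[r r0 rQ] := Q0; exists r => // c cr.
  by apply: rQ; rewrite /ball /= sub0r normrN.
have x1_neq0 : \forall x \near w, coordinate 1 x != 0.
  by apply: (cvgr_neq0 _ cst1).
have x3_neq0 : \forall x \near w, xi 3 x != 0.
  by apply: (cvgr_neq0 _ w_3).
pose t0 := Fx w 0 (Ordinal i1).
(* For a target value t, |[G (x, t)]| bounds the square of the shift of x_k by [exists_near_sqrt].
   It vanishes at (w, t0), so nearby shifts are smaller than [r]. Here [m.+2] is k - 2, the exponent
   of the slope. *)
pose G (z : 'rV[K]_n.+1 * K) :=
  (z.2 * xi 3 z.1 ^+ k.-1 - xi k z.1 ^+ 2) / (coordinate 1 z.1 ^+ m.+2) ^+ 2.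
have G_cvg : G z @[z --> (w, t0)] --> (0 : K).
  have -> : 0 = (t0 * xi 3 w ^+ k.-1 - xi k w ^+ 2) / (coordinate 1 w ^+ m.+2) ^+ 2.
    by rewrite /t0 FxE divfK ?subrr ?mul0r // expf_neq0.
  have fst_cvg : (fun z : 'rV[K]_n.+1 * K => z.1) z @[z --> (w, t0)] --> w.
    exact: cvg_fst.
  apply: cvgM.
    apply: cvgB; last exact: cvg_exprn (cvg_comp _ _ fst_cvg w_k).
    apply: cvgM; first exact: cvg_snd.
    exact: cvg_exprn (cvg_comp _ _ fst_cvg w_3).
  apply: cvgV; first by rewrite !expf_neq0.
  by do 2 apply: cvg_exprn; exact: cvg_comp fst_cvg cst1.
have r2 : 0 < r ^+ 2 by rewrite exprn_gt0.
have /= [[P' Q'] /= [wP' Q't0] PQ'] := cvgr0_norm_lt _ G_cvg _ r2.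
have wB : nbhs w (P `&` P' `&` [set x | coordinate 1 x != 0] `&` [set x | xi 3 x != 0]).
  by do 3 (apply: filterI => //).
have t_near : nbhs (Fx w) [set y : 'rV[K]_(size (casimirs K n)) | Q' (y 0 (Ordinal i1))].
  by apply: (@coord_continuous K 1 _ 0 (Ordinal i1) (Fx w)).
(* The induction hypothesis is used on the shrunken neighbourhood, leaving room for the final
   correction of x_k. *)
apply: filterS (filterI (IHm (ltnW m_lt) _ wB) t_near).
move=> y [[x [[[Px P'x] /= x1] x3] xy] /= Q'y].
have [s s2 s_near] := exists_near_sqrt (xi k x)
  (K_sqrt (y 0 (Ordinal i1) * xi 3 x ^+ k.-1)).
pose c := (s - xi k x) / coordinate 1 x ^+ m.+2.
pose x' := x + c *: 'e_(inord k.-1) : 'rV[K]_n.+1.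
have kn : (3 <= k <= n.+1)%N by rewrite /k; lia.
have xi_k : xi k x' = s.
  rewrite xi_shift ?eqxx ?mul1r //; last by rewrite /k leqnn.
  rewrite (_ : k%:Z - 2 = m.+2); last by rewrite /k; lia.
  by rewrite /c mulrC divfK ?expf_neq0 // addrC subrK.
have coord1 : coordinate 1 x' = coordinate 1 x.
  have k1 : (1 == k)%N = false by [].
  rewrite coordinate_shift; try lia.
  by rewrite k1 mulr0 addr0.
have xi_lt l : (1 < l < k)%N -> xi l x' = xi l x.
  move=> lk; rewrite xi_shift //; last by lia.
  by rewrite (_ : (l == k) = false) ?mul0r ?addr0 //; lia.
exists x'.
  apply: (PQ (x, c)); split=> //=; apply: rQ.
  rewrite -(ltr_pXn2r (n := 2)) ?nnegrE ?normr_ge0 ?(ltW r0) //.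
  apply: le_lt_trans (PQ' (x, y 0 (Ordinal i1)) _) => //.
  rewrite /G /= /c !normf_div expr_div_n !normrX ler_wpM2r ?invr_ge0 ?exprn_ge0 //.
move=> i; rewrite leq_eqVlt => /orP[/eqP i_m|i_m]; last first.
  rewrite -xy // !mxE !nth_casimirs.
  case: (val i) i_m => [_|j jm].
    exact: coord1.
  by case: ifP => // _; rewrite !xi_lt //; rewrite /k; lia.
have -> : i = Ordinal i1 by apply: val_inj.
by rewrite FxE xi_k s2 xi_lt // mulfK // expf_neq0.
Qed.

Lemma casimirs_independent_on (U : set 'rV[K]_n.+1) : (4 <= n)%N ->
  U `<=` casimir_domain K n ->
  functionally_independent_on U (casimirs K n).
Proof.
move=> n_ge4 U_dom W W_open [w Ww] WU [D [H [_ _ H_nz HF]]].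
have : nbhs (Fx w) (Fx @` W).
  have wW : nbhs w W by exact: open_nbhs_nbhs.
  have := casimirs_partial_open (U_dom w (WU w Ww)) (leqnn _) wW.
  apply: filterS => y [x Wx xy]; exists x => //.
  by apply/rowP => i; apply: xy; rewrite -ltnS -(size_casimirs K n) ltn_ord.
rewrite nbhsE => -[B [B_open Bw] B_sub].
(* Each point of [B] is some [Fx x] with [x] in [W]; hence [B] lies in [D] and [H] vanishes on it,
   against [H_nz]. *)
have [||y By Hy] := H_nz B B_open; first by exists (Fx w).
  by move=> y /B_sub[x Wx <-]; have [] := HF x Wx.
have [x Wx xy] := B_sub y By.
by have [_ Hx] := HF x Wx; move: Hy; rewrite -xy Hx eqxx.
Qed.

End Independence.

Theorem mainTheorem7 (R : realType) (n : nat) (V : vectType R[i])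
    (br : V -> V -> V) (e : n.+1.-tuple V) (U : set 'rV[R[i]]_n.+1) :
  (4 <= n)%N ->
  lie_bracket br -> basis_of fullv e -> s_relations br e ->
  is_domain U -> U `<=` casimir_domain R[i] n ->
  complete_set_of_invariants br e U (casimirs R[i] n).
Proof.
move=> n_ge4 br_lie e_basis br_rel _ U_dom; split.
(* The count is (n + 1) - 4 = 1 + (n - 4): [xi 1] and one ratio for each k from 4 to n - 1. *)
- by rewrite size_casimirs /invariant_number coadjoint_generic_rank_eq4 // subSn.
- by move=> i i_lt; exact: casimir_invariant_on.
- apply: casimirs_independent_on => // y.
  by exists (sqrtC y); exact: sqrtCK.
Qed.
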